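(* Let $\mathbf{X}\subset\mathbb{R}^n$ be bounded, let $g_1,\ldots,g_N\in\mathbb{R}[\mathbf{x}]$ be polynomials, and for $i=1,\ldots,N$ let $$\mathbf{X}_i=\{\mathbf{x}\in\mathbf{X} \mid g_i(\mathbf{x})<g_j(\mathbf{x})\ \ \forall j\neq i\}.$$ Let $f:\mathbf{X}\to\mathbb{R}$ be a piecewise polynomial function satisfying $f(\mathbf{x})=h_i(\mathbf{x})$ for all $\mathbf{x}\in\mathbf{X}_i$, $i=1,\ldots,N$, where $h_1,\ldots,h_N\in\mathbb{R}[\mathbf{x}]$. Then there exists a polynomial $\tilde p\in\mathbb{R}[\mathbf{x},y]$ such that $$f(\mathbf{x})=\arg\min_{y\in\mathbb{R}}\tilde p(\mathbf{x},y)\quad\text{for all } \mathbf{x}\in\bigcup_{i=1}^N\mathbf{X}_i\setminus\mathbf{A},$$ where $\mathbf{A}=\{\mathbf{x} \mid h_i(\mathbf{x})=h_j(\mathbf{x})\ \text{for some } i\neq j\}$.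
   Context: $\mathbb{R}[\mathbf{x},y]$ is the ring of real polynomials in $\mathbf{x}\in\mathbb{R}^n$ and $y\in\mathbb{R}$. The equality $f(\mathbf{x})=\arg\min_{y\in\mathbb{R}}\tilde p(\mathbf{x},y)$ means that $y=f(\mathbf{x})$ is the unique global minimizer over $\mathbb{R}$ of the univariate polynomial $y\mapsto\tilde p(\mathbf{x},y)$. The values of $f$ at points of $\mathbf{X}$ outside $\bigcup_i\mathbf{X}_i$ are arbitrary. *)

(* Defs.v *)
From mathcomp Require Import all_boot all_order all_algebra.
From mathcomp Require Import all_classical all_reals all_analysis.
(* The notations of mpoly.v are incompatible with those of mathcomp-analysis;
   the one needed here is redeclared below with its usual meaning. *)
From mathcomp Require Import -(notations) mpoly.

Set Implicit Arguments.
Unset Strict Implicit.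
Unset Printing Implicit Defensive.

Import Order.TTheory GRing.Theory Num.Theory.
Import numFieldNormedType.Exports.

Local Open Scope classical_set_scope.
Local Open Scope ring_scope.

Notation "{ 'mpoly' T [ n ] }" := (mpoly.mpoly n T)
  (at level 0, T, n at level 2, format "{ 'mpoly'  T [ n ] }") : type_scope.

Definition peval (R : realType) (n : nat) (p : {mpoly R[n]}) (x : 'rV[R]_n) : R :=
  meval (fun k => x 0 k) p.

(* [R[x, y]] is [{mpoly R[n.+1]}]: the last variable ([ord_max]) is [y], the
   others are the coordinates of [x] in order. *)
Definition peval2 (R : realType) (n : nat) (p : {mpoly R[n.+1]})
    (x : 'rV[R]_n) (y : R) : R :=
  meval (fun k => if unlift ord_max k is Some i then x 0 i else y) p.

Definition cell (R : realType) (n N : nat) (X : set 'rV[R]_n)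
    (g : 'I_N -> {mpoly R[n]}) (i : 'I_N) : set 'rV[R]_n :=
  [set x | X x /\ forall j, j != i -> peval (g i) x < peval (g j) x].

Definition coincidence (R : realType) (n N : nat)
    (h : 'I_N -> {mpoly R[n]}) : set 'rV[R]_n :=
  [set x | exists i j, i != j /\ peval (h i) x = peval (h j) x].

Definition argmin (R : realType) (F : R -> R) : set R :=
  [set y | forall z, F y <= F z].

(* Main.v *)
(* Fix x, put a_j = h_j(x), assumed distinct, and let P(y) = prod_k (y - a_k).
   Multiplying the Lagrange polynomials of the nodes a_j, corrected by suitable
   multiples of P, by a power of V = prod_(j <> k) (a_j - a_k) clears the
   denominators and gives G_j, polynomial in x and y, with G_j(a_k) = 0 for
   k <> j, G_j(a_j) = V^2 and sum_j G_j^2 = V^4 + S P^2, S independent of y.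
   Then p = sum_j g_j G_j^2 + (1 + (1 + sum_j g_j^2) S) P^2 satisfies
     p - g_i V^4 = sum_(j <> i) (g_j - g_i) G_j^2
                   + (1 + (1 + g_i + sum_j g_j^2) S) P^2.
   When g_i is the strict minimum of the g_j this is nonnegative, and it
   vanishes only at a zero of P where every G_j with j <> i vanishes, that is,
   only at y = a_i. *)

Require Import Defs.
From mathcomp Require Import all_boot all_order all_algebra.
From mathcomp Require Import all_classical all_reals all_analysis.
From mathcomp Require Import -(notations) mpoly.
From mathcomp Require Import ring lra.
Import Order.TTheory GRing.Theory Num.Theory.
Import numFieldNormedType.Exports.
Local Open Scope classical_set_scope.
Local Open Scope ring_scope.

(** * Division-free Lagrange interpolation at the nodes [a j] *)

Section HermiteSquares.
Context {A : comNzRingType} {N : nat}.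
Implicit Types (a g : 'I_N -> A) (y : A).

Definition nodal a y : A := \prod_k (y - a k).

Definition nodal_but a (j : 'I_N) y : A := \prod_(k | k != j) (y - a k).

(** Up to sign, the square of the Vandermonde determinant: each pair of nodes occurs in both
    orders. *)
Definition vdm a : A := \prod_j nodal_but a j (a j).

Definition covdm a (j : 'I_N) : A := \prod_(k | k != j) nodal_but a k (a k).

(** For distinct nodes in a field this is [- vdm a] times the derivative at [a j] of the Lagrange
    polynomial of node [j], which makes the derivative of [bump a j] vanish at [a j]. *)
Definition hermite_slope a (j : 'I_N) : A :=
  \sum_(k | k != j) covdm a k * \prod_(l | (l != j) && (l != k)) (a j - a l).

(* Up to the factor [vdm a ^+ 2], this is the Lagrange polynomial of node [j]
   plus the multiple of the nodal polynomial for which the sum of squares in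
   [sum_bump_sqr] has no term linear in [nodal a y]. *)
Definition bump a (j : 'I_N) y : A :=
  covdm a j * (vdm a * nodal_but a j y + hermite_slope a j * nodal a y).

Definition bump_defect a : A := \sum_j (covdm a j * hermite_slope a j) ^+ 2.

Definition selector a g y : A :=
  \sum_j g j * bump a j y ^+ 2
  + (1 + (1 + \sum_j g j ^+ 2) * bump_defect a) * nodal a y ^+ 2.

Lemma nodalE a j y : nodal a y = (y - a j) * nodal_but a j y.
Proof. by rewrite /nodal (bigD1 j). Qed.

Lemma vdmE a j : vdm a = nodal_but a j (a j) * covdm a j.
Proof. by rewrite /vdm (bigD1 j). Qed.

Lemma nodal_node a j : nodal a (a j) = 0.
Proof. by rewrite (nodalE _ j) subrr mul0r. Qed.

Lemma nodal_but_node a j k : k != j -> nodal_but a j (a k) = 0.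
Proof. by move=> kj; rewrite /nodal_but (bigD1 k) //= subrr mul0r. Qed.

Lemma bump_node a j : bump a j (a j) = vdm a ^+ 2.
Proof. by rewrite /bump nodal_node mulr0 addr0 mulrCA [covdm _ _ * _]mulrC -vdmE. Qed.

Lemma bump_other_node a j k : k != j -> bump a j (a k) = 0.
Proof.
by move=> kj; rewrite /bump nodal_node nodal_but_node // !mulr0 addr0 mulr0.
Qed.

Lemma nodal_butE a j k : k != j ->
  nodal_but a j (a j) = (a j - a k) * \prod_(l | (l != j) && (l != k)) (a j - a l).
Proof. by move=> kj; rewrite /nodal_but (bigD1 k). Qed.

End HermiteSquares.

(** * Compatibility of the construction with ring morphisms *)

Lemma rmorph_nodal_but (A B : comNzRingType) (phi : {rmorphism A -> B}) N
    (a : 'I_N -> A) j y :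
  phi (nodal_but a j y) = nodal_but (phi \o a) j (phi y).
Proof. by rewrite rmorph_prod; apply: eq_bigr => k _; rewrite rmorphB. Qed.

Lemma rmorph_nodal (A B : comNzRingType) (phi : {rmorphism A -> B}) N
    (a : 'I_N -> A) y :
  phi (nodal a y) = nodal (phi \o a) (phi y).
Proof. by rewrite rmorph_prod; apply: eq_bigr => k _; rewrite rmorphB. Qed.

Lemma rmorph_vdm (A B : comNzRingType) (phi : {rmorphism A -> B}) N
    (a : 'I_N -> A) : phi (vdm a) = vdm (phi \o a).
Proof. by rewrite rmorph_prod; apply: eq_bigr => k _; rewrite rmorph_nodal_but. Qed.

Lemma rmorph_covdm (A B : comNzRingType) (phi : {rmorphism A -> B}) N
    (a : 'I_N -> A) j : phi (covdm a j) = covdm (phi \o a) j.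
Proof. by rewrite rmorph_prod; apply: eq_bigr => k _; rewrite rmorph_nodal_but. Qed.

Lemma rmorph_hermite_slope (A B : comNzRingType) (phi : {rmorphism A -> B}) N
    (a : 'I_N -> A) j : phi (hermite_slope a j) = hermite_slope (phi \o a) j.
Proof.
rewrite rmorph_sum; apply: eq_bigr => k _; rewrite rmorphM rmorph_covdm.
by congr (_ * _); rewrite rmorph_prod; apply: eq_bigr => l _; rewrite rmorphB.
Qed.

Lemma rmorph_bump (A B : comNzRingType) (phi : {rmorphism A -> B}) N
    (a : 'I_N -> A) j y : phi (bump a j y) = bump (phi \o a) j (phi y).
Proof.
by rewrite rmorphM rmorphD !rmorphM rmorph_covdm rmorph_vdm rmorph_nodal_but
  rmorph_hermite_slope rmorph_nodal.
Qed.

Lemma rmorph_selector (A B : comNzRingType) (phi : {rmorphism A -> B}) N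
    (a g : 'I_N -> A) y :
  phi (selector a g y) = selector (phi \o a) (phi \o g) (phi y).
Proof.
rewrite rmorphD rmorph_sum rmorphM rmorphXn rmorph_nodal; congr (_ + _ * _).
  by apply: eq_bigr => j _; rewrite rmorphM rmorphXn rmorph_bump.
rewrite rmorphD rmorphM rmorphD rmorph1 !rmorph_sum.
congr (_ + (_ + _) * _); apply: eq_bigr => j _; rewrite rmorphXn //.
by rewrite rmorphM rmorph_covdm rmorph_hermite_slope.
Qed.

(** * The sum of squares of the bumps *)

Section Identity.
Context {A : idomainType} {N : nat}.
Variable a : 'I_N -> A.
Hypothesis a_inj : injective a.

Lemma vdm_neq0 : vdm a != 0.
Proof.
apply/prodf_neq0 => j _; apply/prodf_neq0 => k kj.
by rewrite subr_eq0 eq_sym (inj_eq a_inj).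
Qed.

(** Both sides have degree less than [N] in [y] and agree at the [N] distinct nodes. *)
Lemma sum_lagrange y : (0 < N)%N -> \sum_j covdm a j * nodal_but a j y = vdm a.
Proof.
move=> N_gt0.
pose q : {poly A} :=
  \sum_j covdm a j *: \prod_(k | k != j) ('X - (a k)%:P) - (vdm a)%:P.
have qE z : q.[z] = \sum_j covdm a j * nodal_but a j z - vdm a.
  rewrite hornerD hornerN hornerC horner_sum; congr (_ - _).
  apply: eq_bigr => j _; rewrite hornerZ horner_prod; congr (_ * _).
  by apply: eq_bigr => k _; rewrite hornerXsubC.
suff q0 : q = 0 by apply/eqP; rewrite -subr_eq0 -qE q0 horner0.
apply: (@roots_geq_poly_eq0 _ _ (codom a)).
- apply/allP => _ /codomP[i ->]; rewrite rootE qE (bigD1 i) //= big1.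
    by rewrite addr0 mulrC -vdmE subrr.
  by move=> j ji; rewrite nodal_but_node ?mulr0 // eq_sym.
- by rewrite map_inj_uniq ?enum_uniq.
rewrite size_codom card_ord (leq_trans (size_polyD _ _)) // size_polyN geq_max.
rewrite (leq_trans (size_polyC_leq1 _)) // andbT.
apply: (leq_trans (size_sum _ _ _)); apply/bigmax_leqP => j _.
apply: (leq_trans (size_scale_leq _ _)).
rewrite -big_filter size_prod_XsubC -[X in (_ <= X)%N]prednK // ltnS.
by rewrite -sum1_size big_filter sum1_card cardC1 card_ord.
Qed.

(** With [Pj = P / (y - a j)], this is the partial fraction identity
    [(a j - a k) * Pj * Pk = P * (Pj - Pk)], multiplied by [V] and with [a j - a k] cancelled. *)
Lemma nodal_but_pair j k y : k != j ->
  vdm a * (nodal_but a j y * nodal_but a k y) = nodal a y *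
    (covdm a j * nodal_but a j y * \prod_(l | (l != j) && (l != k)) (a j - a l) +
     covdm a k * nodal_but a k y * \prod_(l | (l != k) && (l != j)) (a k - a l)).
Proof.
move=> kj; have jk : j != k by rewrite eq_sym.
have ajk : a j - a k != 0 by rewrite subr_eq0 (inj_eq a_inj) // eq_sym.
apply: (mulfI ajk).
have := vdmE a j; have := vdmE a k; rewrite (nodal_butE _ _ _ jk) (nodal_butE _ _ _ kj).
have := nodalE a j y; have := nodalE a k y.
set P := nodal a y; set V := vdm a; set Pj := nodal_but _ j y.
set Pk := nodal_but _ k y; set Fk := \prod_(l | _) _; set Fj := \prod_(l | _) _.
move=> Hk Hj Vk Vj.
have -> : (a j - a k) * (P * (covdm a j * Pj * Fj + covdm a k * Pk * Fk)) =
  P * (Pj * ((a j - a k) * Fj * covdm a j) - Pk * ((a k - a j) * Fk * covdm a k)).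
  by ring.
rewrite -Vj -Vk.
have -> : P * (Pj * V - Pk * V) = V * (P * Pj - P * Pk) by ring.
by rewrite {1}Hk Hj; ring.
Qed.

(** Squaring [bump a j y = V * L j + covdm a j * hermite_slope a j * P], the terms linear in [P] add
    up to the cross terms of [(V * \sum_j L j) ^+ 2], which is [V ^+ 4]. *)
Lemma sum_bump_sqr y : (0 < N)%N ->
  \sum_j bump a j y ^+ 2 = vdm a ^+ 4 + bump_defect a * nodal a y ^+ 2.
Proof.
move=> N_gt0.
set V := vdm a; set P := nodal a y.
pose L j := covdm a j * nodal_but a j y.
pose F j k := \prod_(l | (l != j) && (l != k)) (a j - a l).
pose T j k := P * (L j * (covdm a j * covdm a k * F j k)).
have -> : \sum_j bump a j y ^+ 2 = V ^+ 2 * \sum_j L j ^+ 2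
  + 2 * V * \sum_j \sum_(k | k != j) T j k + bump_defect a * P ^+ 2.
  rewrite mulr_suml !mulr_sumr -!big_split /=; apply: eq_bigr => j _.
  have -> : \sum_(k | k != j) T j k = P * L j * covdm a j * hermite_slope a j.
    by rewrite mulr_sumr; apply: eq_bigr => k _; rewrite /T /F; ring.
  by rewrite /bump -/V -/P /L; ring.
congr (_ + _).
have -> : V ^+ 4 = V ^+ 2 * ((\sum_j L j) * (\sum_j L j)).
  by rewrite sum_lagrange // -/V; ring.
have -> : (\sum_j L j) * (\sum_j L j) =
    \sum_j L j ^+ 2 + \sum_j \sum_(k | k != j) L j * L k.
  rewrite mulr_suml -big_split; apply: eq_bigr => j _ /=.
  by rewrite mulr_sumr (bigD1 j).
rewrite mulrDr; congr (_ + _).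
(* Symmetrised in [j] and [k], since [nodal_but_pair] yields [V * (L j * L k) = T j k + T k j]. *)
have -> : 2 * V * \sum_j \sum_(k | k != j) T j k
    = V * \sum_j \sum_(k | k != j) (T j k + T k j).
  have sumC : \sum_j \sum_(k | k != j) T k j = \sum_j \sum_(k | k != j) T j k.
    rewrite (exchange_big_dep xpredT) //=; apply: eq_bigr => j _.
    by apply: eq_bigl => k; rewrite eq_sym.
  under [in RHS]eq_bigr do rewrite big_split.
  by rewrite big_split /= sumC; ring.
rewrite expr2 -mulrA; congr (_ * _); rewrite mulr_sumr; apply: eq_bigr => j _.
rewrite mulr_sumr; apply: eq_bigr => k kj.
have := nodal_but_pair _ _ y kj; rewrite -/V -/P -/(F j k) -/(F k j) => VP.
have -> : V * (L j * L k) =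
    covdm a j * covdm a k * (V * (nodal_but a j y * nodal_but a k y)).
  by rewrite /L; ring.
by rewrite VP /T /L; ring.
Qed.

End Identity.

(** * The minimum of the selector in an ordered domain *)

Section Minimum.
Context {R : realDomainType} {N : nat}.
Variables (a g : 'I_N -> R) (i : 'I_N).
Hypothesis a_inj : injective a.
Hypothesis g_min : forall j, j != i -> g i < g j.

Lemma selector_excess y : selector a g y - g i * vdm a ^+ 4 =
  \sum_(j | j != i) (g j - g i) * bump a j y ^+ 2
  + (1 + (1 + g i + \sum_j g j ^+ 2) * bump_defect a) * nodal a y ^+ 2.
Proof.
have N_gt0 : (0 < N)%N by case: (N) i => [[]|].
have -> : \sum_(j | j != i) (g j - g i) * bump a j y ^+ 2 =
    \sum_j g j * bump a j y ^+ 2 - g i * \sum_j bump a j y ^+ 2.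
  rewrite mulr_sumr -sumrB [RHS](bigD1 i) //= subrr add0r.
  by apply: eq_bigr => j _; rewrite mulrBl.
by rewrite sum_bump_sqr // /selector; ring.
Qed.

(** For [t = g i], [2 * (1 + t + t ^+ 2) = 1 + t ^+ 2 + (t + 1) ^+ 2]; thus [1 + \sum_j g j ^+ 2]
    outweighs [- g i] whichever [i] is. *)
Lemma selector_coef_gt0 :
  0 < 1 + (1 + g i + \sum_j g j ^+ 2) * bump_defect a.
Proof.
apply: ltr_pwDl => //; apply: mulr_ge0; last by apply: sumr_ge0 => j _; exact: sqr_ge0.
rewrite (bigD1 i) //=.
have : 0 <= \sum_(j | j != i) g j ^+ 2 by apply: sumr_ge0 => j _; exact: sqr_ge0.
have : 0 <= (g i + 1) ^+ 2 by exact: sqr_ge0.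
have : 0 <= g i ^+ 2 by exact: sqr_ge0.
nra.
Qed.

Lemma selector_node : selector a g (a i) = g i * vdm a ^+ 4.
Proof.
apply/eqP; rewrite -subr_eq0 selector_excess nodal_node expr0n mulr0 addr0.
apply/eqP; rewrite big1 // => j ji.
by rewrite bump_other_node ?expr0n ?mulr0 // eq_sym.
Qed.

Lemma selector_ge y : g i * vdm a ^+ 4 <= selector a g y.
Proof.
rewrite -subr_ge0 selector_excess; apply: addr_ge0.
  apply: sumr_ge0 => j ji; apply: mulr_ge0; last exact: sqr_ge0.
  by rewrite subr_ge0 ltW // g_min.
by apply: mulr_ge0; [exact: ltW selector_coef_gt0 | exact: sqr_ge0].
Qed.

Lemma selector_eq y : selector a g y = g i * vdm a ^+ 4 -> y = a i.
Proof.
move=> /eqP; rewrite -subr_eq0 selector_excess.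
have F_ge0 j : j != i -> 0 <= (g j - g i) * bump a j y ^+ 2.
  move=> ji; apply: mulr_ge0; last exact: sqr_ge0.
  by rewrite subr_ge0 ltW // g_min.
rewrite paddr_eq0; first last.
- by apply: mulr_ge0; [exact: ltW selector_coef_gt0 | exact: sqr_ge0].
- exact: sumr_ge0.
case/andP => /eqP /(psumr_eq0P F_ge0) bump0.
rewrite mulf_eq0 gt_eqF ?selector_coef_gt0 //= sqrf_eq0 => /prodf_eq0[k _].
rewrite subr_eq0 => /eqP yE; have [ki|ki] := eqVneq k i; first by rewrite yE ki.
(* At a node [a k] with [k != i], the bump [k] equals [vdm a ^+ 2], nonzero because the nodes are
   distinct. *)
have /eqP := bump0 k ki.
rewrite mulf_eq0 subr_eq0 gt_eqF ?g_min //= yE bump_node !expf_eq0 /=.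
by rewrite (negPf (vdm_neq0 _ a_inj)).
Qed.

End Minimum.

Lemma peval2_mwiden (R : realType) n (q : {mpoly R[n]}) x y :
  peval2 (mwiden q) x y = peval q x.
Proof.
rewrite /peval2 /peval; elim/mpolyind: q => [|c m q _ _ IHq].
  by rewrite mwiden0 !meval0.
rewrite mwidenD !mevalD IHq mwidenZ !mevalZ mwidenX !mevalX; congr (_ * _ + _).
(* The added variable has exponent 0 in a widened monomial, so [y] drops out. *)
rewrite big_ord_recr /= mnmwiden_ordmax expr0 mulr1; apply: eq_bigr => k _.
rewrite mnmwiden_widen (_ : widen_ord _ _ = lift ord_max k) ?liftK //.
by apply: val_inj; rewrite [RHS]lift_max.
Qed.

Theorem corollary2p2 (R : realType) (n N : nat) (X : set 'rV[R]_n)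
    (g h : 'I_N -> {mpoly R[n]}) (f : X -> R) :
  bounded_set X ->
  (forall (i : 'I_N) (x : X), cell X g i (val x) -> f x = peval (h i) (val x)) ->
  exists p : {mpoly R[n.+1]}, forall x : X,
    ((\bigcup_i cell X g i) `\` coincidence h) (val x) ->
    argmin (peval2 p (val x)) = [set f x].
Proof.
move=> _ fE.
(* The selector is formed in [{mpoly R[n.+1]}] itself; evaluation at [x] and [y], a ring morphism,
   turns it into the selector of the real values. *)
pose p := selector (@mwiden _ _ \o h) (@mwiden _ _ \o g) (mpolyX R (mnm1 (@ord_max n))).
exists p; move=> x [[i _ xi] xNA]; rewrite (fE _ _ xi); case: xi => _ g_min.
pose a k := peval (h k) (val x); pose c k := peval (g k) (val x).
have pE y : peval2 p (val x) y = selector a c y.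
  rewrite /peval2 rmorph_selector /= mevalXU unlift_none.
  congr (selector _ _ _); apply/funext => k; exact: peval2_mwiden.
have a_inj : injective a.
  move=> j k ajk; apply/eqP; apply: contrapT => /negP jk.
  by apply: xNA; exists j, k.
apply/seteqP; split => [y ymin|_ ->] /=.
  apply: (selector_eq a c i) => //.
  (* A minimizer does no worse than [a i], where the lower bound is attained. *)
  apply/le_anti; rewrite (selector_ge a c i) // andbT.
  by rewrite -(selector_node a c i) // -!pE; exact: ymin.
by move=> z; rewrite !pE (selector_node a c i) // selector_ge.
Qed.
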